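(* Let $k$ be an algebraically closed field of characteristic $0$ and let $A\subset k[a,b]$ be a normal, finitely generated, homogeneous (for the grading by total degree) $k$-subalgebra. Then $A$ is admissible if and only if for all pairs of homogeneous polynomials $p_1=\sum_{i=0}^{n_1}z_{1,i}\,a^ib^{n_1-i}$ and $p_2=\sum_{j=0}^{n_2}z_{2,j}\,a^jb^{n_2-j}$ in $A$ (of degrees $n_1$ and $n_2$), all of the polynomials $w_s^{p_1,p_2}$, $0\le s\le\min(n_1,n_2)$, defined by \[ w_s^{p_1,p_2}=\sum_{\alpha=s}^{n_1+n_2-s}y_{\alpha,s}^{p_1,p_2}\,a^{\alpha-s}\,b^{n_1+n_2-\alpha-s} \] with \[ y_{\alpha,s}^{p_1,p_2}=\sum_{i+j=\alpha}\ \sum_{e=0}^{s}(-1)^e\,\frac{\binom{s}{e}}{\binom{n_1}{e}\binom{n_2}{s-e}}\binom{n_1-i}{e}\binom{n_2-j}{s-e}\,z_{1,i}\,z_{2,j} \] also belong to $A$. (In the sum, $0\le i\le n_1$ and $0\le j\le n_2$.)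
   Context: Write $k[SL_2]=k[a,b,c,d]/(ad-bc-1)$, where $\begin{bmatrix} a&b\\c&d\end{bmatrix}$ is the generic matrix, and let $SL_2$ act on $k[SL_2]$ by the left regular representation $(g\cdot f)(x)=f(g^{-1}x)$. Then $k[a,b]\subset k[SL_2]$ is the algebra of invariants under the group $\overline{U}$ of lower triangular unipotent matrices. A subalgebra $A\subset k[a,b]$ is called admissible if: (a) $A$ is homogeneous for the grading by total degree; (b) $A$ is normal and finitely generated; (c) the $SL_2$-subrepresentation $V_A$ of $k[SL_2]$ generated by $A$ is closed under multiplication (i.e. is a subalgebra of $k[SL_2]$). *)

(* Defs.v *)
From HB Require Import structures.
From mathcomp Require Import all_boot all_algebra.
From mathcomp Require Import boolp.
From mathcomp Require Import mpoly.

Set Implicit Arguments.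
Unset Strict Implicit.
Unset Printing Implicit Defensive.

Import GRing.Theory.
Local Open Scope ring_scope.
Local Open Scope quotient_scope.
Local Notation "x %:F" := (@tofrac _ x).

(* The variables a, b, c, d of k[a,b,c,d] are 'X_0, 'X_1, 'X_2, 'X_3. *)
Section CoordinateRing.
Variable k : fieldType.

Definition generic_mx : 'M[{mpoly k[4]}]_2 :=
  \matrix_(i, j) 'X_(inord (2 * i + j)%N).

Definition SL2_rel : {mpoly k[4]} :=
  generic_mx 0 0 * generic_mx 1 1 - generic_mx 0 1 * generic_mx 1 0 - 1.

Definition SL2_ideal : {pred {mpoly k[4]}} :=
  fun f => `[< exists h, f = h * SL2_rel >].

Lemma SL2_idealP f :
  reflect (exists h, f = h * SL2_rel) (f \in SL2_ideal).
Proof. exact: asboolP. Qed.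

Lemma SL2_ideal_closed : idealr_closed SL2_ideal.
Proof.
split.
- by apply/SL2_idealP; exists 0; rewrite mul0r.
- apply/negP => /SL2_idealP[h /(congr1 (meval (fun i : 'I_4 => ((i == 0%N :> nat) || (i == 3%N :> nat))%:R : k)))].
  rewrite /SL2_rel /generic_mx !mxE mevalM !mevalB !mevalM !mevalXU meval1 !inordK //=.
  by rewrite mulr1 mul0r subr0 subrr mulr0 => /eqP; rewrite oner_eq0.
- move=> a u v /SL2_idealP[hu ->] /SL2_idealP[hv ->].
  by apply/SL2_idealP; exists (a * hu + hv); rewrite mulrDl mulrA.
Qed.

HB.instance Definition _ :=
  isIdealr.Build {mpoly k[4]} SL2_ideal SL2_ideal_closed.

Definition kSL2 := {ideal_quot SL2_ideal}.

Definition kSL2_scale (t : k) (u : kSL2) : kSL2 := \pi_kSL2 t%:MP * u.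

(* f |-> f(g^-1 x) on k[a,b,c,d]; it fixes SL2_rel when \det g = 1, so it
   descends to kSL2, see kSL2_act_pi. *)
Definition mpoly_act (g : 'M[k]_2) (f : {mpoly k[4]}) : {mpoly k[4]} :=
  let y := map_mx (@mpolyC 4 k) (invmx g) *m generic_mx in
  f \mPo [tuple y 0 0; y 0 1; y 1 0; y 1 1].

Definition kSL2_act (g : 'M[k]_2) (u : kSL2) : kSL2 :=
  \pi_kSL2 (mpoly_act g (repr u)).

Definition kab_to_kSL2 (p : {mpoly k[2]}) : kSL2 :=
  \pi_kSL2 (p \mPo [tuple generic_mx 0 0; generic_mx 0 1]).

Lemma mpoly_act_rel g : \det g = 1 -> mpoly_act g SL2_rel = SL2_rel.
Proof.
move=> dg1.
pose y := map_mx (@mpolyC 4 k) (invmx g) *m generic_mx.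
have det2 (R : comNzRingType) (M : 'M[R]_2) :
    \det M = M 0 0 * M 1 1 - M 0 1 * M 1 0.
  rewrite (expand_det_row _ 0) !big_ord_recl big_ord0 addr0 /cofactor !det_mx11 !mxE /=.
  rewrite expr0 mul1r expr1 mulN1r mulrN.
  by congr (M _ _ * M _ _ - M _ _ * M _ _); apply/val_inj.
have -> : SL2_rel = \det generic_mx - 1 by rewrite /SL2_rel det2.
have -> : mpoly_act g (\det generic_mx - 1) = \det y - 1.
  rewrite /mpoly_act -/y !det2 comp_mpolyB comp_mpoly1 comp_mpolyB.
  by rewrite !rmorphM /= !mxE !comp_mpolyXU !inordK //= -!/y.
rewrite det_mulmx det_map_mx det_inv dg1 invr1 /=.
by rewrite mpolyC1 mul1r.
Qed.

Lemma kSL2_act_pi g (f : {mpoly k[4]}) : \det g = 1 ->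
  kSL2_act g (\pi_kSL2 f) = \pi_kSL2 (mpoly_act g f).
Proof.
move=> dg1; apply/eqP; rewrite /kSL2_act -Quotient.idealrBE.
have : repr (\pi_kSL2 f) - f \in SL2_ideal.
  by rewrite Quotient.idealrBE reprK.
move=> /SL2_idealP[h e]; apply/SL2_idealP; exists (mpoly_act g h).
by rewrite -comp_mpolyB e rmorphM /= -[_ \mPo _ in X in _ * X]/(mpoly_act g _) mpoly_act_rel.
Qed.

Lemma kab_to_kSL2_inj : injective kab_to_kSL2.
Proof.
move=> p q /eqP; rewrite -Quotient.idealrBE -comp_mpolyB => /SL2_idealP[h e].
apply/eqP; rewrite -subr_eq0; move: (p - q) e => {p q} p e.
pose K := {fraction {mpoly k[2]}}.
pose a : K := ('X_0 : {mpoly k[2]})%:F; pose b : K := ('X_1 : {mpoly k[2]})%:F.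
have a0 : a != 0.
  by rewrite tofrac_eq0; apply/eqP => /(congr1 (meval (fun=> 1 : k)))/eqP;
     rewrite mevalXU meval0 oner_eq0.
pose v (i : 'I_4) : K := [tuple a; b; 0; a^-1]`_i.
pose phi : {rmorphism {mpoly k[4]} -> K} :=
  mmap (@tofrac {mpoly k[2]} \o @mpolyC 2 k) v.
have phiX (i : 'I_4) : phi 'X_i = v i by rewrite /phi /= mmapX mmap1U.
have phiC c : phi c%:MP = c%:MP%:F by rewrite /phi /= mmapC.
clearbody phi.
have phirel : phi SL2_rel = 0.
  rewrite /SL2_rel /generic_mx !mxE !rmorphB !rmorphM rmorph1 /=.
  by rewrite !phiX /v !inordK //= mulfV // mulr0 subr0 subrr.
have := congr1 phi e; rewrite rmorphM /= phirel mulr0.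
suff -> : phi (p \mPo [tuple generic_mx 0 0; generic_mx 0 1]) = p%:F.
  by move/eqP; rewrite tofrac_eq0.
rewrite comp_mpolyEX rmorph_sum [in RHS](mpolyE p) rmorph_sum /=.
apply: eq_bigr => m _.
rewrite -!mul_mpolyC !rmorphM /= phiC; congr (_ * _).
rewrite comp_mpolyX rmorph_prod mpolyXE_id rmorph_prod /=.
apply: eq_bigr => i _; rewrite !rmorphXn /=; congr (_ ^+ _).
by case: i => [[|[|//]] lti]; rewrite /tnth /= mxE phiX /v inordK //=;
  congr (tofrac 'X_ _); apply/val_inj.
Qed.

End CoordinateRing.

Section Subalgebras.
Variable k : fieldType.
Implicit Type A : {pred {mpoly k[2]}}.

Definition graded_subalg A :=
  forall d : nat, {in A, forall p, pihomog mdeg d p \in A}.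

Definition fin_gen_subalg A :=
  exists n (s : n.-tuple {mpoly k[2]}),
    forall f, f \in A <-> exists P : {mpoly k[n]}, f = P \mPo s.

(* A is integrally closed in Frac(A), which is realized inside Frac(k[a,b]) as
   the set of quotients p / q of elements of A. *)
Definition normal_subalg A :=
  forall p q, p \in A -> q \in A -> q != 0 ->
  (exists P : {poly {mpoly k[2]}},
    [/\ P \is monic, P \is a polyOver A
      & root (map_poly (@tofrac {mpoly k[2]}) P) (p%:F / q%:F)]) ->
  exists2 r, r \in A & p%:F / q%:F = r%:F.

(* The smallest SL2(k)-stable k-subspace of k[SL2] containing A; the group
   SL2(k) is the set of g : 'M[k]_2 with \det g = 1. *)
Inductive gen_subrep A : kSL2 k -> Prop :=
| gen_subrep_incl p of p \in A : gen_subrep A (kab_to_kSL2 p)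
| gen_subrep_zero : gen_subrep A 0
| gen_subrep_add u v of gen_subrep A u & gen_subrep A v :
    gen_subrep A (u + v)
| gen_subrep_scale t u of gen_subrep A u : gen_subrep A (kSL2_scale t u)
| gen_subrep_act g u of \det g = 1 & gen_subrep A u :
    gen_subrep A (kSL2_act g u).

Definition admissible A :=
  [/\ GRing.subalg_closed A,
      graded_subalg A,
      normal_subalg A /\ fin_gen_subalg A
    & forall u v, gen_subrep A u -> gen_subrep A v -> gen_subrep A (u * v)].

(* The exponent of a^i b^j; for p homogeneous of degree n, the coefficient
   z_i of a^i b^(n-i) in p is p@_(mon_ab i (n - i)). *)
Definition mon_ab (i j : nat) : 'X_{1..2} := [multinom of [:: i; j]].

Definition y_coef (n1 n2 : nat) (p1 p2 : {mpoly k[2]}) (al s : nat) : k :=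
  \sum_(i < n1.+1) \sum_(j < n2.+1 | (i + j == al)%N) \sum_(e < s.+1)
    (-1) ^+ e * ('C(s, e)%:R / ('C(n1, e)%:R * 'C(n2, s - e)%:R))
    * 'C(n1 - i, e)%:R * 'C(n2 - j, s - e)%:R
    * p1@_(mon_ab i (n1 - i)) * p2@_(mon_ab j (n2 - j)).

Definition w_poly (n1 n2 : nat) (p1 p2 : {mpoly k[2]}) (s : nat) :
    {mpoly k[2]} :=
  \sum_(s <= al < (n1 + n2 - s).+1)
    y_coef n1 n2 p1 p2 al s *: 'X_[mon_ab (al - s) (n1 + n2 - al - s)].

End Subalgebras.

(* Main.v *)
(* Let D = c d/da + d d/db and E = a d/dc + b d/dd, two derivations of
   k[a,b,c,d] that kill ad - bc.  By Taylor's formula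
   g.p = \sum_e x^(n-e) y^e D^e p / e! for p in k[a,b] of degree n, where (x, y)
   is the first row of g^-1; hence V_A is the span of the D^e p with p in A.
   Since E^e D^e p = e! n(n-1)...(n-e+1) p, an element of k[a,b] lying in this
   span is in A.

   The s-th transvectant
     T_s = \sum_e (-1)^e 'C(s,e) / (n1^_e n2^_(s-e)) D^e p1 D^(s-e) p2
   is (ad - bc)^s times an element of k[a,b], which is w_s (set c = 0, d = 1).
   So w_s lies in V_A as soon as V_A is closed under products.  Conversely, modulo
   the image under D of the products D^e p1 D^(s-1-e) p2, all the products
   D^e p1 D^(s-e) p2 agree up to sign and T_s is a nonzero multiple of each of
   them, so by induction on s they are all in V_A.

   Identities that are linear in p are checked on the powers (a + t b)^n, which
   span the forms of degree n in characteristic 0 and satisfy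
   D^e (a + t b)^n = n^_e (a + t b)^(n-e) (c + t d)^e. *)
Require Import Defs.
From HB Require Import structures.
From mathcomp Require Import all_boot all_algebra.
From mathcomp Require Import mpoly.
From mathcomp Require Import ring zify.

Set Implicit Arguments.
Unset Strict Implicit.
Unset Printing Implicit Defensive.

Import GRing.Theory.
Local Open Scope ring_scope.

Lemma natr_neq0 (k : fieldType) (char0 : [pchar k] =i pred0) n :
  (0 < n)%N -> n%:R != 0 :> k.
Proof. by rewrite ((pcharf0P k).1 char0) -lt0n. Qed.

(** * Subspaces as predicates, and extraction of coefficients *)

Section Subspaces.
Variables (k : fieldType) (V : lmodType k).

Definition subspace (S : V -> Prop) :=
  S 0 /\ forall c u v, S u -> S v -> S (c *: u + v).

Variable S : V -> Prop.
Hypothesis subS : subspace S.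

Lemma subspaceD u v : S u -> S v -> S (u + v).
Proof. by move=> Su Sv; rewrite -[u]scale1r; apply: subS.2. Qed.

Lemma subspaceZ c u : S u -> S (c *: u).
Proof. by move=> Su; rewrite -[_ *: _]addr0; apply: subS.2 => //; apply: subS.1. Qed.

Lemma subspaceB u v : S u -> S v -> S (u - v).
Proof. by move=> Su Sv; apply: subspaceD => //; rewrite -scaleN1r; apply: subspaceZ. Qed.

Lemma subspaceZ_inv c u : c != 0 -> S (c *: u) -> S u.
Proof. by move=> c0 Scu; rewrite -(scalerK c0 u); apply: subspaceZ. Qed.

Lemma subspace_sum (I : Type) (r : seq I) (P : pred I) (F : I -> V) :
  (forall i, P i -> S (F i)) -> S (\sum_(i <- r | P i) F i).
Proof.
move=> SF; elim/big_ind: _ => //; [exact: subS.1 | exact: subspaceD].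
Qed.

(* f(2t) - 2^N f(t) eliminates the top coefficient of f(t) = \sum t^e x_e. *)
Lemma subspace_coef (char0 : [pchar k] =i pred0) N (x : nat -> V) :
  (forall t : k, S (\sum_(e < N) t ^+ e *: x e)) ->
  forall e, (e < N)%N -> S (x e).
Proof.
elim: N x => // N IHN x Sx.
have Slow e : (e < N)%N -> S (x e).
  move=> ltN; apply: (@subspaceZ_inv (2%:R ^+ e - 2%:R ^+ N)).
    rewrite subr_eq0 -!natrX; apply/eqP => /eqP; rewrite eq_sym -subr_eq0 -natrB.
      by rewrite ((pcharf0P k).1 char0) subn_eq0 leq_exp2l // leqNgt ltN.
    by rewrite leq_exp2l // ltnW.
  apply: (IHN (fun e => (2%:R ^+ e - 2%:R ^+ N) *: x e)) => // t.
  have := subspaceB (Sx (2%:R * t)) (subspaceZ (2%:R ^+ N) (Sx t)).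
  rewrite !big_ord_recr /= scalerDr scaler_sumr exprMn scalerA.
  rewrite [X in _ - X]addrC addrKA -sumrB => St; congr S: St.
  by apply: eq_bigr => i _; rewrite !scalerA -scalerBl exprMn; congr (_ *: _); ring.
move=> e; rewrite ltnS leq_eqVlt => /orP[/eqP-> | /Slow //].
have := Sx 1; rewrite big_ord_recr /= expr1n scale1r => S1.
rewrite -[x N](addKr (\sum_(i < N) 1 ^+ i *: x i)) addrC; apply: subspaceB => //.
by apply: subspace_sum => i _; apply/subspaceZ/Slow.
Qed.

End Subspaces.

(** * Binary forms and powers of linear forms *)

Section PowerForms.
Variable k : fieldType.

Lemma mderivXU n (i j : 'I_n) : ('X_i : {mpoly k[n]})^`M(j) = (i == j)%:R.
Proof.
rewrite mderivX mnmE; case: eqP => [->|_]; last by rewrite scale0r.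
rewrite scale1r -mpolyX0; congr mpolyX; apply/mnmP => l.
by rewrite mnmBE subnn mnm0E.
Qed.

Lemma lrmorph_mpoly_eq n m (F G : {lrmorphism {mpoly k[n]} -> {mpoly k[m]}}) :
  (forall i, F 'X_i = G 'X_i) -> F =1 G.
Proof.
move=> eFG p; rewrite (mpolyE p) !raddf_sum; apply: eq_bigr => m' _ /=.
rewrite !linearZ mpolyXE_id !rmorph_prod; congr (_ *: _); apply: eq_bigr => i _ /=.
by rewrite !rmorphXn /= eFG.
Qed.

Lemma mpolyX_mon_ab i j : 'X_[mon_ab i j] = 'X_0 ^+ i * 'X_1 ^+ j :> {mpoly k[2]}.
Proof.
rewrite mpolyXE_id !big_ord_recl big_ord0 mulr1 !multinomE /=.
by congr (_ * 'X_ _ ^+ _); apply: val_inj.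
Qed.

Lemma mon_ab_eta (m : 'X_{1..2}) : m = mon_ab (m 0) (m 1).
Proof.
apply/mnmP => -[[|[|//]] lti]; rewrite multinomE /tnth /=; congr (m _);
exact: val_inj.
Qed.

Lemma mdeg_mon_ab i j : mdeg (mon_ab i j) = (i + j)%N.
Proof. by rewrite mdegE !big_ord_recl big_ord0 addn0 !multinomE. Qed.

Lemma mon_ab_eq i j i' j' : (mon_ab i j == mon_ab i' j') = (i == i') && (j == j').
Proof.
apply/eqP/andP => [/mnmP e|[/eqP-> /eqP->] //].
by have := e 0; have := e 1; rewrite !multinomE /tnth /= => -> ->.
Qed.

Lemma homog_sum_mon_ab n (p : {mpoly k[2]}) : p \is n.-homog ->
  p = \sum_(i < n.+1) p@_(mon_ab i (n - i)) *: 'X_[mon_ab i (n - i)].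
Proof.
move=> homp; apply/mpolyP => m; rewrite (raddf_sum (mcoeff m)) /=.
have [degm | degm] := eqVneq (mdeg m) n; last first.
  rewrite (dhomog_nemf_coeff homp) // big1 // => i _.
  rewrite mcoeffZ mcoeffX; case: eqP => [e|_]; last by rewrite mulr0.
  by case/eqP: degm; rewrite -e mdeg_mon_ab subnKC // -ltnS.
move: degm; rewrite {1}(mon_ab_eta m) mdeg_mon_ab => degm.
have lt0 : (m 0%R < n.+1)%N by rewrite ltnS -degm leq_addr.
rewrite (bigD1 (Ordinal lt0)) //= big1 ?addr0 => [|i ne_i].
  have e1 : (n - m 0%R)%N = m 1%R by rewrite -degm addKn.
  by rewrite mcoeffZ mcoeffX /= e1 -mon_ab_eta eqxx mulr1.
rewrite mcoeffZ mcoeffX (mon_ab_eta m) mon_ab_eq; case: eqP => [e|_]; last by rewrite mulr0.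
by case/eqP: ne_i; apply: val_inj.
Qed.

Definition lin_form (t : k) : {mpoly k[2]} := 'X_0 + t *: 'X_1.

(** The expansion of [lin_form t ^+ n] is a polynomial in t whose coefficients are binomial
    multiples of the monomials; [subspace_coef] extracts them, and the binomials are invertible in
    characteristic 0. *)
Lemma subspace_power (char0 : [pchar k] =i pred0) (S : {mpoly k[2]} -> Prop) n :
  subspace S -> (forall t, S (lin_form t ^+ n)) ->
  forall p, p \is n.-homog -> S p.
Proof.
move=> subS Spow p homp; rewrite (homog_sum_mon_ab homp).
apply: subspace_sum => // i _; apply: subspaceZ => //.
have lei : (i <= n)%N by rewrite -ltnS.
pose x e : {mpoly k[2]} := 'C(n, e)%:R *: 'X_[mon_ab (n - e) e].
suff : S (x (n - i)%N).
  rewrite /x subKn // bin_sub //; apply: subspaceZ_inv => //.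
  by rewrite (natr_neq0 char0) // bin_gt0.
apply: (@subspace_coef _ _ _ subS char0 n.+1 x); last by rewrite ltnS leq_subr.
move=> t; have := Spow t; rewrite exprDn; congr S; apply: eq_bigr => e _.
by rewrite /x mpolyX_mon_ab exprZn -scalerAr -scaler_nat !scalerA mulrC.
Qed.

(** Only the components of the given p are involved, so that facts such as p in A remain available
    for them through [graded_subalg]. *)
Lemma subspace_pihomog (S : {mpoly k[2]} -> Prop) p :
  subspace S -> (forall n, S (pihomog mdeg n p)) -> S p.
Proof.
move=> subS Sp; have -> := @pihomog_partitionE _ _ mdeg _ p (leqnn _).
exact: subspace_sum.
Qed.

End PowerForms.

(** * The derivations D = [lower] and E = [raise], and Taylor's formula *)

Section Derivations.
Variables (k : fieldType).
Local Notation R := {mpoly k[4]}.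

Section PowerRule.
Variable D : {linear R -> R}.
Hypothesis DM : forall f g, D (f * g) = D f * g + f * D g.

Lemma der1 : D 1 = 0.
Proof.
have := DM 1 1; rewrite !mulr1 mul1r => D1.
by apply: (addIr (D 1)); rewrite add0r -D1.
Qed.

Lemma der_constX f n : D f = 0 -> D (f ^+ n) = 0.
Proof.
move=> Df; elim: n => [|n IHn]; first by rewrite expr0 der1.
by rewrite exprS DM Df IHn mul0r mulr0 addr0.
Qed.

Lemma der_powM L M N n : D L = M -> D M = 0 -> D N = 0 ->
  D (L ^+ n * N) = (L ^+ n.-1 * M * N) *+ n.
Proof.
move=> DL DM0 DN; rewrite DM DN mulr0 addr0.
suff -> : D (L ^+ n) = (L ^+ n.-1 * M) *+ n by rewrite mulrnAl.
elim: n => [|n IHn]; first by rewrite expr0 der1.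
rewrite exprS DM IHn DL /= mulrnAr mulrA; case: n {IHn} => [|n].
  by rewrite /= !expr0 mulr0n addr0 mulr1n mulr1 mul1r.
by rewrite /= -exprS mulrC -mulrS.
Qed.

(** The constant N absorbs the powers of M during the induction. The lemma serves [lower] with L =
    [upper_form] and, with the roles exchanged, [raise] with L = [lower_form]. *)
Lemma iter_der_powM L M N n e : D L = M -> D M = 0 -> D N = 0 ->
  iter e D (L ^+ n * N) = (L ^+ (n - e) * M ^+ e * N) *+ (n ^_ e).
Proof.
move=> DL DM0 DN; elim: e => [|e IHe] /=; first by rewrite subn0 mulr1.
rewrite IHe linearMn /= -mulrA (@der_powM _ M) //; last first.
  by rewrite DM DN der_constX // mul0r mulr0 addr0.
by rewrite subnS -mulrnA mulnC -ffactnSr exprS !mulrA.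
Qed.

Lemma iter_derD e f g : iter e D (f + g) = iter e D f + iter e D g.
Proof. by elim: e => //= e ->; rewrite linearD. Qed.

Lemma iter_derZ e c f : iter e D (c *: f) = c *: iter e D f.
Proof. by elim: e => //= e ->; rewrite linearZ. Qed.

Lemma iter_der0 e : iter e D 0 = 0.
Proof. by elim: e => //= e ->; rewrite linear0. Qed.

Lemma iter_der_sum e (I : Type) (r : seq I) (P : pred I) (F : I -> R) :
  iter e D (\sum_(i <- r | P i) F i) = \sum_(i <- r | P i) iter e D (F i).
Proof.
by elim: e => // e IHe /=; rewrite IHe linear_sum.
Qed.

Lemma iter_der_constM e f g : D g = 0 -> iter e D (f * g) = iter e D f * g.
Proof. by move=> Dg; elim: e => //= e ->; rewrite DM Dg mulr0 addr0. Qed.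

End PowerRule.

Definition lower (f : R) : R :=
  f^`M(inord 0) * 'X_(inord 2) + f^`M(inord 1) * 'X_(inord 3).
Definition raise (f : R) : R :=
  f^`M(inord 2) * 'X_(inord 0) + f^`M(inord 3) * 'X_(inord 1).

Fact lower_is_linear : linear lower.
Proof. by move=> c f g; rewrite /lower !linearP /= !mulrDl scalerDr -!scalerAl addrACA. Qed.
Fact raise_is_linear : linear raise.
Proof. by move=> c f g; rewrite /raise !linearP /= !mulrDl scalerDr -!scalerAl addrACA. Qed.

HB.instance Definition _ := GRing.isLinear.Build k R R *:%R lower lower_is_linear.
HB.instance Definition _ := GRing.isLinear.Build k R R *:%R raise raise_is_linear.

Lemma lowerM f g : lower (f * g) = lower f * g + f * lower g.
Proof. by rewrite /lower !mderivM; ring. Qed.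

Lemma raiseM f g : raise (f * g) = raise f * g + f * raise g.
Proof. by rewrite /raise !mderivM; ring. Qed.

Lemma inord4_ind (P : 'I_4 -> Prop) :
  P (inord 0) -> P (inord 1) -> P (inord 2) -> P (inord 3) -> forall i, P i.
Proof. by move=> P0 P1 P2 P3 i; rewrite -[i]inord_val; case: i => [[|[|[|[|]]]]]. Qed.

Local Lemma inord4_eq i j : (i < 4)%N -> (j < 4)%N -> (inord i == inord j :> 'I_4) = (i == j).
Proof. by move=> lti ltj; rewrite -val_eqE /= !inordK. Qed.

Local Notation va := ('X_(inord 0) : R).
Local Notation vb := ('X_(inord 1) : R).
Local Notation vc := ('X_(inord 2) : R).
Local Notation vd := ('X_(inord 3) : R).

Lemma generic_mxE : (generic_mx k 0 0 = va) * (generic_mx k 0 1 = vb)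
  * (generic_mx k 1 0 = vc) * (generic_mx k 1 1 = vd).
Proof. by rewrite !mxE. Qed.

Lemma SL2_relE : SL2_rel k = va * vd - vb * vc - 1.
Proof. by rewrite /SL2_rel !generic_mxE. Qed.

Lemma lowerX : (lower va = vc) * (lower vb = vd) * (lower vc = 0) * (lower vd = 0).
Proof. by rewrite /lower !mderivXU !inord4_eq //= !mul0r !mul1r addr0 add0r addr0. Qed.

Lemma raiseX : (raise va = 0) * (raise vb = 0) * (raise vc = va) * (raise vd = vb).
Proof. by rewrite /raise !mderivXU !inord4_eq //= !mul0r !mul1r addr0 add0r addr0. Qed.

Lemma lower_rel : lower (SL2_rel k) = 0.
Proof.
rewrite SL2_relE !linearB /= !lowerM !lowerX (der1 lowerM).
by ring.
Qed.

Lemma raise_rel : raise (SL2_rel k) = 0.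
Proof.
rewrite SL2_relE !linearB /= !raiseM !raiseX (der1 raiseM).
by ring.
Qed.

Definition iota_ab (p : {mpoly k[2]}) : R := p \mPo [tuple generic_mx k 0 0; generic_mx k 0 1].

HB.instance Definition _ := GRing.LRMorphism.copy iota_ab
  (comp_mpoly [tuple generic_mx k 0 0; generic_mx k 0 1]).

Definition upper_form t : R := va + t *: vb.
Definition lower_form t : R := vc + t *: vd.

Lemma iota_lin_form t : iota_ab (lin_form t) = upper_form t.
Proof.
by rewrite /lin_form linearD linearZ /= /iota_ab !comp_mpolyXU /= !generic_mxE.
Qed.

Lemma lower_upper_form t : lower (upper_form t) = lower_form t.
Proof. by rewrite linearD linearZ /= !lowerX. Qed.
Lemma lower_lower_form t : lower (lower_form t) = 0.
Proof. by rewrite linearD linearZ /= !lowerX scaler0 addr0. Qed.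
Lemma raise_upper_form t : raise (upper_form t) = 0.
Proof. by rewrite linearD linearZ /= !raiseX scaler0 addr0. Qed.
Lemma raise_lower_form t : raise (lower_form t) = upper_form t.
Proof. by rewrite linearD linearZ /= !raiseX. Qed.

Lemma iter_lower_power t n e :
  iter e lower (iota_ab (lin_form t ^+ n))
  = (upper_form t ^+ (n - e) * lower_form t ^+ e) *+ (n ^_ e).
Proof.
rewrite rmorphXn /= iota_lin_form -[_ ^+ n]mulr1.
rewrite (iter_der_powM lowerM _ _ (lower_upper_form t) (lower_lower_form t)) ?mulr1 //.
exact: der1 lowerM.
Qed.

Hypothesis char0 : [pchar k] =i pred0.

Lemma iter_lower_homog0 n e p : (n < e)%N -> p \is n.-homog ->
  iter e lower (iota_ab p) = 0.
Proof.
move=> ltne; move: p; apply: (subspace_power char0) => [|t].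
  split=> [|c u v Su Sv]; first by rewrite linear0 iter_der0.
  by rewrite linearP iter_derD iter_derZ Su Sv scaler0 addr0.
by rewrite iter_lower_power ffact_small.
Qed.

(** For L = a + tb and M = c + td, D^e sends L^n to n^_e L^(n-e) M^e; then E, which kills L and
    sends M to L, makes e! L^e out of M^e. *)
Lemma iter_raise_lower n e p : p \is n.-homog ->
  iter e raise (iter e lower (iota_ab p)) = iota_ab p *+ (n ^_ e * e`!).
Proof.
move: p; apply: (subspace_power char0) => [|t].
  split=> [|c u v Su Sv]; first by rewrite linear0 !iter_der0 mul0rn.
  by rewrite linearP !iter_derD !iter_derZ Su Sv mulrnDl scalerMnr.
have [ltne|leen] := ltnP n e.
  by rewrite iter_lower_power ffact_small // mul0n mulr0n iter_der0.
rewrite iter_lower_power -scaler_nat iter_derZ mulrC.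
rewrite (iter_der_powM raiseM _ _ (raise_lower_form t) (raise_upper_form t)); last first.
  exact: (der_constX raiseM _ (raise_upper_form t)).
rewrite subnn mul1r -exprD subnKC // ffactnn scaler_nat -mulrnA mulnC.
by rewrite rmorphXn /= iota_lin_form.
Qed.

Lemma raise_iota p : raise (iota_ab p) = 0.
Proof.
have subE : subspace (fun p => raise (iota_ab p) = 0).
  split=> [|c u v Su Sv]; first by rewrite !linear0.
  by rewrite !linearP /= Su Sv scaler0 addr0.
apply: (subspace_pihomog subE) => n.
apply: (subspace_power char0 subE _ (pihomogP mdeg n p)) => t.
by rewrite rmorphXn /= iota_lin_form (der_constX raiseM _ (raise_upper_form t)).
Qed.

(** On (a + tb)^n this is the binomial expansion of (xL + yM)^n with L = a + tb and M = c + td,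
    since n^_e / e! is a binomial coefficient. *)
Lemma taylor_lower n p (x y : k) : p \is n.-homog ->
  p \mPo [tuple x *: va + y *: vc; x *: vb + y *: vd]
  = \sum_(e < n.+1) (x ^+ (n - e) * y ^+ e / e`!%:R) *: iter e lower (iota_ab p).
Proof.
move: p; apply: (subspace_power char0) => [|t].
  split=> [|c u v Su Sv].
    by rewrite linear0 big1 // => e _; rewrite linear0 iter_der0 scaler0.
  rewrite comp_mpolyD comp_mpolyZ Su Sv scaler_sumr -big_split; apply: eq_bigr => e _ /=.
  by rewrite linearP iter_derD iter_derZ scalerDr !scalerA [c * _]mulrC.
rewrite rmorphXn /= /lin_form comp_mpolyD comp_mpolyZ !comp_mpolyXU /=.
have -> : x *: va + y *: vc + t *: (x *: vb + y *: vd)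
    = x *: upper_form t + y *: lower_form t.
  by rewrite /upper_form /lower_form -!mul_mpolyC; ring.
rewrite exprDn; apply: eq_bigr => e _; rewrite iter_lower_power.
rewrite !exprZn -scalerAl -scalerAr -scaler_nat -[in RHS]scaler_nat !scalerA; congr (_ *: _).
have f0 : e`!%:R != 0 :> k by rewrite (natr_neq0 char0) // fact_gt0.
by rewrite -bin_ffact natrM mulrC; field.
Qed.

End Derivations.

(** * Transvectants and their identification with the w_s *)

Section Transvectants.
Variables (k : fieldType).
Hypothesis char0 : [pchar k] =i pred0.
Local Notation R := {mpoly k[4]}.
Local Notation va := ('X_(inord 0) : R).
Local Notation vb := ('X_(inord 1) : R).
Local Notation vc := ('X_(inord 2) : R).
Local Notation vd := ('X_(inord 3) : R).
Local Notation D := (@lower k).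

(* Sends ad - bc to a and turns c d/da + d d/db into d/db. *)
Definition ev01 (f : R) : {mpoly k[2]} := f \mPo [tuple 'X_0; 'X_1; 0; 1].

HB.instance Definition _ := GRing.LRMorphism.copy ev01
  (comp_mpoly [tuple 'X_0; 'X_1; 0; 1]).

Lemma ev01X : (ev01 va = 'X_0) * (ev01 vb = 'X_1) * (ev01 vc = 0) * (ev01 vd = 1).
Proof. by rewrite /ev01 !comp_mpolyXU !inordK. Qed.

Lemma ev01_iota p : ev01 (iota_ab p) = p.
Proof.
apply: (@subspace_pihomog _ (fun p => ev01 (iota_ab p) = p)) => [|n].
  by split=> [|c u v Su Sv]; rewrite ?linear0 // !linearP /= Su Sv.
move: (pihomog mdeg n p) (pihomogP mdeg n p); apply: (subspace_power char0) => [|t].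
  by split=> [|c u v Su Sv]; rewrite ?linear0 // !linearP /= Su Sv.
by rewrite !rmorphXn /= iota_lin_form /upper_form linearD linearZ /= !ev01X.
Qed.

(** Both sides are derivations along [ev01], so agreement on the four variables suffices. *)
Lemma ev01_lower f : ev01 (D f) = (ev01 f)^`M(1).
Proof.
have evM f1 f2 : ev01 (D f1) = (ev01 f1)^`M(1) -> ev01 (D f2) = (ev01 f2)^`M(1) ->
    ev01 (D (f1 * f2)) = (ev01 (f1 * f2))^`M(1).
  by move=> e1 e2; rewrite lowerM rmorphD !rmorphM /= mderivM e1 e2.
have ev1 : ev01 (D 1) = (ev01 1)^`M(1).
  by rewrite rmorph1 (der1 (@lowerM k)) linear0 -mpolyC1 mderivC.
have subE : subspace (fun f => ev01 (D f) = (ev01 f)^`M(1)).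
  split=> [|c u v Su Sv]; first by rewrite !linear0.
  by rewrite !linearP /= Su Sv.
rewrite (mpolyE f); apply: (subspace_sum subE) => m _; apply: (subspaceZ subE).
rewrite mpolyXE_id.
elim/big_ind: _ => [||i _]; [exact: ev1 | exact: evM |].
elim: (m i) => [|n IHn]; first exact: ev1.
rewrite exprS; apply: evM; last exact: IHn.
elim/inord4_ind: i {IHn}.
- by rewrite lowerX !ev01X mderivXU.
- by rewrite lowerX !ev01X mderivXU.
- by rewrite lowerX !ev01X !linear0.
- by rewrite lowerX !ev01X linear0 -mpolyC1 mderivC.
Qed.

Lemma ev01_iter_lower e p : ev01 (iter e D (iota_ab p)) = p^`M(1, e).
Proof.
elim: e => [|e IHe] /=; first by rewrite ev01_iota mderivn0.
by rewrite ev01_lower IHe -mderivnS.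
Qed.

Lemma mderivn_homog n e (p : {mpoly k[2]}) : p \is n.-homog -> p^`M(1, e)
  = \sum_(i < n.+1) (p@_(mon_ab i (n - i)) * ((n - i) ^_ e)%:R) *: 'X_[mon_ab i (n - i - e)].
Proof.
move=> homp; rewrite {1}(homog_sum_mon_ab homp) linear_sum; apply: eq_bigr => i _ /=.
rewrite linearZ /= mderivnX multinomE /tnth /= scalerA; congr (_ *: mpolyX _ _).
apply/mnmP => j; rewrite mnmBE mulmnE mnm1E !multinomE.
by case: j => [[|[|//]] ltj]; rewrite /tnth /= ?mul0n ?mul1n ?subn0.
Qed.

(** The denominators are the falling factorials that D^e and D^(s-e) produce on powers of degrees n1
    and n2. *)
Definition transvectant n1 n2 s (p1 p2 : {mpoly k[2]}) : R :=
  \sum_(e < s.+1) ((-1) ^+ e * 'C(s, e)%:R / ((n1 ^_ e)%:R * (n2 ^_ (s - e))%:R))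
     *: (iter e D (iota_ab p1) * iter (s - e) D (iota_ab p2)).

Lemma transvectantDl n1 n2 s c p1 p1' p2 : transvectant n1 n2 s (c *: p1 + p1') p2
  = c *: transvectant n1 n2 s p1 p2 + transvectant n1 n2 s p1' p2.
Proof.
rewrite scaler_sumr -big_split; apply: eq_bigr => e _ /=.
by rewrite linearP iter_derD iter_derZ mulrDl -scalerAl scalerDr !scalerA [c * _]mulrC.
Qed.

Lemma transvectantDr n1 n2 s c p1 p2 p2' : transvectant n1 n2 s p1 (c *: p2 + p2')
  = c *: transvectant n1 n2 s p1 p2 + transvectant n1 n2 s p1 p2'.
Proof.
rewrite scaler_sumr -big_split; apply: eq_bigr => e _ /=.
by rewrite linearP iter_derD iter_derZ mulrDr -scalerAr scalerDr !scalerA [c * _]mulrC.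
Qed.

Lemma transvectant0l n1 n2 s p2 : transvectant n1 n2 s 0 p2 = 0.
Proof. by rewrite -[0 in LHS](subrr 0) -scaleN1r addrC transvectantDl scaleN1r addNr. Qed.

Lemma transvectant0r n1 n2 s p1 : transvectant n1 n2 s p1 0 = 0.
Proof. by rewrite -[0 in LHS](subrr 0) -scaleN1r addrC transvectantDr scaleN1r addNr. Qed.

(** Once the falling factorials cancel, the sum is L^(n1-s) L'^(n2-s) times the binomial expansion
    of (LM' - L'M)^s, and LM' - L'M = (t' - t)(ad - bc). *)
Lemma transvectant_power n1 n2 s t t' : (s <= n1)%N -> (s <= n2)%N ->
  transvectant n1 n2 s (lin_form t ^+ n1) (lin_form t' ^+ n2)
  = (va * vd - vb * vc) ^+ s
    * iota_ab ((t' - t) ^+ s *: (lin_form t ^+ (n1 - s) * lin_form t' ^+ (n2 - s))).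
Proof.
move=> les1 les2.
rewrite linearZ /= rmorphM /= !rmorphXn /= !iota_lin_form.
rewrite -scalerAr scalerAl -exprZn.
set L := upper_form t; set L' := upper_form t'.
pose M := lower_form t; pose M' := lower_form t'.
have -> : (t' - t) *: (va * vd - vb * vc) = L * M' - L' * M.
  by rewrite /L /L' /M /M' /upper_form /lower_form -!mul_mpolyC mpolyCB; ring.
rewrite exprBn mulr_suml; apply: eq_bigr => e _.
have lee : (e <= s)%N by rewrite -ltnS.
rewrite !iter_lower_power -/L -/L' -/M -/M'.
rewrite -[(L ^+ _ * _) *+ _]scaler_nat -[(L' ^+ _ * _) *+ _]scaler_nat.
rewrite -[(_ *: _) * (_ *: _)]scalerAl -scalerAr !scalerA.
have -> : (-1) ^+ e * 'C(s, e)%:R / ((n1 ^_ e)%:R * (n2 ^_ (s - e))%:R)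
    * (n1 ^_ e)%:R * (n2 ^_ (s - e))%:R = (-1) ^+ e * 'C(s, e)%:R :> k.
  have f1 : (n1 ^_ e)%:R != 0 :> k by rewrite (natr_neq0 char0) // ffact_gt0; lia.
  have f2 : (n2 ^_ (s - e))%:R != 0 :> k by rewrite (natr_neq0 char0) // ffact_gt0; lia.
  by field; rewrite f1 f2.
rewrite !exprMn -(subnK les1) -(subnK les2).
have -> : (n1 - s + s - e = (n1 - s) + (s - e))%N by lia.
have -> : (n2 - s + s - (s - e) = (n2 - s) + e)%N by lia.
rewrite !addnK !exprD -mul_mpolyC mpolyCM rmorph_sign -[in RHS]mulr_natr mpolyC_nat.
ring.
Qed.

(** Having such a w is a linear condition on each argument, so two uses of [subspace_power] leave a
    pair of powers. *)
Lemma transvectant_det n1 n2 s p1 p2 : (s <= n1)%N -> (s <= n2)%N ->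
  p1 \is n1.-homog -> p2 \is n2.-homog ->
  exists w, transvectant n1 n2 s p1 p2 = (va * vd - vb * vc) ^+ s * iota_ab w.
Proof.
move=> les1 les2 hom1 hom2; move: p1 hom1.
apply: (subspace_power char0) => [|t].
  split=> [|c u v [w ew] [w' ew']]; first by exists 0; rewrite transvectant0l linear0 mulr0.
  by exists (c *: w + w'); rewrite transvectantDl ew ew' linearP /= mulrDr scalerAr.
move: p2 hom2; apply: (subspace_power char0) => [|t'].
  split=> [|c u v [w ew] [w' ew']]; first by exists 0; rewrite transvectant0r linear0 mulr0.
  by exists (c *: w + w'); rewrite transvectantDr ew ew' linearP /= mulrDr scalerAr.
by eexists; rewrite transvectant_power.
Qed.

Lemma w_poly_coef n1 n2 s (p1 p2 : {mpoly k[2]}) x y :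
  (w_poly n1 n2 p1 p2 s)@_(mon_ab x y)
  = if (x + y + s.*2 == n1 + n2)%N then y_coef n1 n2 p1 p2 (x + s) s else 0.
Proof.
rewrite raddf_sum /=.
have term al : (s <= al < (n1 + n2 - s).+1)%N ->
    (y_coef n1 n2 p1 p2 al s *: 'X_[mon_ab (al - s) (n1 + n2 - al - s)])@_(mon_ab x y)
    = if (al == x + s)%N && (x + y + s.*2 == n1 + n2)%N
      then y_coef n1 n2 p1 p2 (x + s) s else 0.
  move=> bnd; rewrite mcoeffZ mcoeffX mon_ab_eq.
  have -> : (al - s == x)%N && (n1 + n2 - al - s == y)%N
      = (al == x + s)%N && (x + y + s.*2 == n1 + n2)%N by lia.
  by case: eqP => [->|_] /=; [case: ifP; rewrite ?mulr1 ?mulr0 | rewrite mulr0].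
rewrite (eq_big_nat _ _ term); case: ifP => [/eqP e|_]; last first.
  by rewrite big1 // => al _; rewrite andbF.
under eq_bigr do rewrite andbT.
rewrite -big_mkcond big_nat1_eq ifT //; lia.
Qed.

(** Under [ev01] the equation becomes a^s w = a sum of products of b-derivatives of p1 and p2; the
    coefficients of a^(x+s) b^y are compared. *)
Lemma transvectant_w_poly n1 n2 s p1 p2 w : (s <= n1)%N -> (s <= n2)%N ->
  p1 \is n1.-homog -> p2 \is n2.-homog ->
  transvectant n1 n2 s p1 p2 = (va * vd - vb * vc) ^+ s * iota_ab w ->
  w = w_poly n1 n2 p1 p2 s.
Proof.
move=> les1 les2 hom1 hom2 /(congr1 ev01).
rewrite rmorphM rmorphXn rmorphB !rmorphM /= !ev01X mulr1 mulr0 subr0 ev01_iota.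
rewrite /transvectant linear_sum => ew.
apply/mpolyP => m; rewrite (mon_ab_eta m); move: (m 0) (m 1) => x y {m}.
rewrite w_poly_coef.
have -> : w@_(mon_ab x y) = ('X_0 ^+ s * w)@_(mon_ab (x + s) y).
  have -> : 'X_0 ^+ s = 'X_[mon_ab s 0] :> {mpoly k[2]} by rewrite mpolyX_mon_ab expr0 mulr1.
  rewrite mulrC -(mcoeffMX w (mon_ab s 0)); congr (_ @_ _); apply/mnmP => j.
  rewrite mnmDE !multinomE.
  by case: j => [[|[|//]] ltj]; rewrite /tnth /= ?addn0 // addnC.
rewrite -ew raddf_sum /=.
under eq_bigr => e _ do rewrite linearZ rmorphM /= !ev01_iter_lower
  (mderivn_homog _ hom1) (mderivn_homog _ hom2) mulr_suml scaler_sumr raddf_sum /=.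
rewrite exchange_big /=.
(* The degree condition moves inside the sums of [y_coef] one at a time, so that both sides match
   term by term in i, j, e. *)
have -> : (if (x + y + s.*2 == n1 + n2)%N then y_coef n1 n2 p1 p2 (x + s) s else 0)
    = \sum_(i < n1.+1) (if (x + y + s.*2 == n1 + n2)%N then
     \sum_(j < n2.+1 | (i + j == x + s)%N) \sum_(e < s.+1)
    (-1) ^+ e * ('C(s, e)%:R / ('C(n1, e)%:R * 'C(n2, s - e)%:R))
    * 'C(n1 - i, e)%:R * 'C(n2 - j, s - e)%:R
    * p1@_(mon_ab i (n1 - i)) * p2@_(mon_ab j (n2 - j)) else 0).
  by case: ifP => // _; rewrite big1.
apply: eq_bigr => i _.
under eq_bigr => e _ do rewrite mulr_sumr scaler_sumr raddf_sum /=.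
rewrite exchange_big /=.
have -> (b : bool) (P : pred 'I_n2.+1) (F : 'I_n2.+1 -> k) :
    (if b then \sum_(j | P j) F j else 0) = \sum_j (if b && P j then F j else 0).
  by case: b => /=; rewrite ?big_mkcond // big1.
apply: eq_bigr => j _.
have -> (b : bool) (F : 'I_s.+1 -> k) :
    (if b then \sum_e F e else 0) = \sum_e (if b then F e else 0).
  by case: b => //; rewrite big1.
apply: eq_bigr => e _.
rewrite -scalerAl -scalerAr !mcoeffZ -mpolyXD mcoeffX.
have lee : (e <= s)%N by rewrite -ltnS.
(* If e > n1 - i or s - e > n2 - j, both terms vanish; otherwise no subtraction in the exponents is
   truncated. *)
have [lt1|le1] := ltnP (n1 - i) e.
  by rewrite (bin_small lt1) (ffact_small lt1) !(mulr0, mul0r) if_same.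
have [lt2|le2] := ltnP (n2 - j) (s - e).
  by rewrite (bin_small lt2) (ffact_small lt2) !(mulr0, mul0r) if_same.
have -> : (mon_ab i (n1 - i - e) + mon_ab j (n2 - j - (s - e)))%MM
    = mon_ab (i + j) (n1 + n2 - (i + j) - s).
  apply/mnmP => l; rewrite mnmDE !multinomE.
  case: l => [[|[|//]] ltl]; rewrite /tnth //=.
  by move: (ltn_ord i) (ltn_ord j); lia.
rewrite mon_ab_eq.
have -> : (i + j == x + s)%N && (n1 + n2 - (i + j) - s == y)%N
    = (x + y + s.*2 == n1 + n2)%N && (i + j == x + s)%N.
  by move: (ltn_ord i) (ltn_ord j); lia.
case: ifP => _; last by rewrite !mulr0.
(* Falling factorials are binomials times e! or (s - e)!, and these factorials cancel. *)
rewrite mulr1 -!bin_ffact !natrM.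
have b1 : 'C(n1, e)%:R != 0 :> k by rewrite (natr_neq0 char0) // bin_gt0; lia.
have b2 : 'C(n2, s - e)%:R != 0 :> k by rewrite (natr_neq0 char0) // bin_gt0; lia.
have f1 : e`!%:R != 0 :> k by rewrite (natr_neq0 char0) // fact_gt0.
have f2 : (s - e)`!%:R != 0 :> k by rewrite (natr_neq0 char0) // fact_gt0.
by field; rewrite b1 b2 f1 f2.
Qed.

End Transvectants.

(** * V_A as the span of the D^e(A) modulo the relation *)

Section GeneratedSubrep.
Variables (k : fieldType).
Hypothesis char0 : [pchar k] =i pred0.
Local Notation R := {mpoly k[4]}.
Local Notation va := ('X_(inord 0) : R).
Local Notation vb := ('X_(inord 1) : R).
Local Notation vc := ('X_(inord 2) : R).
Local Notation vd := ('X_(inord 3) : R).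
Local Notation D := (@lower k).
Local Notation E := (@raise k).
Local Notation rel := (SL2_rel k).
Local Notation pi := (\pi_(kSL2 k)%qT).

Lemma pi_eqP f g : (pi f = pi g) <-> (exists h, f = g + h * rel).
Proof.
split=> [/eqP|[h ->]].
  rewrite -Quotient.idealrBE => /SL2_idealP[h e]; exists h; rewrite -e; ring.
apply/eqP; rewrite -Quotient.idealrBE; apply/SL2_idealP; exists h; ring.
Qed.

(** The substitution of xX for the generic matrix X; [invmx] undoes the inversion built into
    [mpoly_act], for singular x as well. *)
Definition sub_mx (x : 'M[k]_2) (f : R) : R := mpoly_act (invmx x) f.

HB.instance Definition _ x := GRing.LRMorphism.copy (sub_mx x)
  (comp_mpoly (let y := map_mx (@mpolyC 4 k) (invmx (invmx x)) *m generic_mx k in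
     [tuple y 0 0; y 0 1; y 1 0; y 1 1])).

Lemma mpoly_actE g f : mpoly_act g f = sub_mx (invmx g) f.
Proof. by rewrite /sub_mx invmxK. Qed.

Lemma sub_mxX x : (sub_mx x va = x 0 0 *: va + x 0 1 *: vc)
  * (sub_mx x vb = x 0 0 *: vb + x 0 1 *: vd)
  * (sub_mx x vc = x 1 0 *: va + x 1 1 *: vc)
  * (sub_mx x vd = x 1 0 *: vb + x 1 1 *: vd).
Proof.
rewrite /sub_mx /mpoly_act invmxK !comp_mpolyXU !inordK //=.
have l01 : lift ord0 ord0 = 1 :> 'I_2 by apply: val_inj.
rewrite ![(_ *m _) _ _]mxE !big_ord_recl !big_ord0 !addr0 l01 !generic_mxE.
by rewrite ![map_mx _ _ _ _]mxE -!mul_mpolyC.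
Qed.

Lemma sub_mx_rel x : \det x = 1 -> sub_mx x rel = rel.
Proof. by move=> dx; rewrite /sub_mx mpoly_act_rel // det_inv dx invr1. Qed.

Lemma sub_mx_mul x y f : sub_mx x (sub_mx y f) = sub_mx (y *m x) f.
Proof.
have l01 : lift ord0 ord0 = 1 :> 'I_2 by apply: val_inj.
apply: (@lrmorph_mpoly_eq _ _ _ (sub_mx x \o sub_mx y) (sub_mx (y *m x))) => i /=.
elim/inord4_ind: i; rewrite !sub_mxX linearD !linearZ /= !sub_mxX !mxE;
by rewrite !big_ord_recl !big_ord0 /= !addr0 -!mul_mpolyC !mpolyCD !mpolyCM l01; ring.
Qed.

Lemma sub_mx1 f : sub_mx 1%:M f = f.
Proof.
apply: (@lrmorph_mpoly_eq _ _ _ (sub_mx 1%:M) idfun) => i /=.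
by elim/inord4_ind: i; rewrite !sub_mxX !mxE /= ?scale1r ?scale0r ?addr0 ?add0r.
Qed.

Variable A : {pred {mpoly k[2]}}.
Hypothesis subalgA : GRing.subalg_closed A.
Hypothesis gradedA : graded_subalg A.

Lemma subspaceA : subspace (fun p => p \in A).
Proof.
case: subalgA => A1 Alin _; split=> [|c u v]; last exact: Alin.
by rewrite -(addNr 1) -scaleN1r; apply: Alin.
Qed.

(* Membership of the class of f in the span of the D^e(A). *)
Definition lower_span (f : R) := exists N (r : nat -> {mpoly k[2]}) h,
  (forall e, r e \in A) /\ f = \sum_(e < N) iter e D (iota_ab (r e)) + h * rel.

Lemma iter_lower_ideal e h : iter e D (h * rel) = iter e D h * rel.
Proof. exact: (iter_der_constM (@lowerM k) _ _ (lower_rel k)). Qed.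

Lemma lower_span_iota e p : p \in A -> lower_span (iter e D (iota_ab p)).
Proof.
move=> Ap; exists e.+1, (fun i => if i == e then p else 0), 0; split=> [i|].
  by case: ifP => // _; apply: subspaceA.1.
rewrite mul0r addr0 big_ord_recr /= eqxx big1 ?add0r // => i _.
by rewrite ifN ?linear0 ?iter_der0 // neq_ltn ltn_ord.
Qed.

Lemma lower_span_widen N M (r : nat -> {mpoly k[2]}) : (N <= M)%N -> (forall e, r e \in A) ->
  exists2 r' : nat -> {mpoly k[2]}, (forall e, r' e \in A)
  & \sum_(e < N) iter e D (iota_ab (r e)) = \sum_(e < M) iter e D (iota_ab (r' e)).
Proof.
move=> leNM Ar; exists (fun e => if (e < N)%N then r e else 0) => [e|].
  by case: ifP => // _; apply: subspaceA.1.
rewrite (big_ord_widen _ (fun e => iter e D (iota_ab (r e))) leNM) big_mkcond.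
by apply: eq_bigr => e _; case: ifP => // _; rewrite linear0 iter_der0.
Qed.

Lemma subspace_lower_span : subspace lower_span.
Proof.
split=> [|c u v [N [r [h [Ar ->]]]] [M [r' [h' [Ar' ->]]]]].
  exists 0%N, (fun _ => 0), 0; split=> [_|]; first exact: subspaceA.1.
  by rewrite big_ord0 mul0r addr0.
have [s As ->] := lower_span_widen (leq_maxl N M) Ar.
have [s' As' ->] := lower_span_widen (leq_maxr N M) Ar'.
exists (maxn N M), (fun e => c *: s e + s' e), (c *: h + h'); split=> [e|].
  exact: subspaceA.2.
rewrite scalerDr addrACA mulrDl -scalerAl; congr (_ + _).
rewrite scaler_sumr -big_split; apply: eq_bigr => e _ /=.
by rewrite linearP iter_derD iter_derZ.
Qed.

Lemma lower_span_ideal h : lower_span (h * rel).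
Proof.
exists 0%N, (fun _ => 0), h; split=> [_|]; first exact: subspaceA.1.
by rewrite big_ord0 add0r.
Qed.

Lemma lower_span_pi f g : pi f = pi g -> lower_span g -> lower_span f.
Proof.
move=> /pi_eqP[h ->] Wg; apply: (subspaceD subspace_lower_span) => //.
exact: lower_span_ideal.
Qed.

(** D kills [SL2_rel], hence preserves its ideal. *)
Lemma lower_span_lower f : lower_span f -> lower_span (D f).
Proof.
case=> N [r [h [Ar ->]]]; rewrite linearD linear_sum /=.
apply: (subspaceD subspace_lower_span); last first.
  by rewrite -[D _]/(iter 1 D _) iter_lower_ideal; apply: lower_span_ideal.
apply: (subspace_sum subspace_lower_span) => e _.
by rewrite -[lower _]/(iter e.+1 D _); apply: lower_span_iota.
Qed.

Lemma sub_mx_iota x p : sub_mx x (iota_ab p)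
  = p \mPo [tuple x 0 0 *: va + x 0 1 *: vc; x 0 0 *: vb + x 0 1 *: vd].
Proof.
apply: (@lrmorph_mpoly_eq _ _ _ (sub_mx x \o @iota_ab k) (comp_mpoly _)) => i /=.
rewrite /iota_ab !comp_mpolyXU /=; case: i => [[|[|//]] lti] /=;
by rewrite generic_mxE sub_mxX.
Qed.

(** Taylor's formula is applied to each homogeneous component, which lies in A by [gradedA]. *)
Lemma lower_span_sub_iota x p : p \in A -> lower_span (sub_mx x (iota_ab p)).
Proof.
move=> Ap; apply: (@subspace_pihomog _ (fun p => lower_span (sub_mx x (iota_ab p)))).
  split=> [|c u v Su Sv]; first by rewrite !linear0; apply: subspace_lower_span.1.
  by rewrite !linearP /=; apply: subspace_lower_span.2 Su Sv.
move=> n; rewrite sub_mx_iota (taylor_lower char0 _ _ (pihomogP mdeg n p)).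
apply: (subspace_sum subspace_lower_span) => e _; apply: (subspaceZ subspace_lower_span).
exact/lower_span_iota/gradedA.
Qed.

(** Quantifying over every representative f and every x makes the induction pass the group action:
    acting by g only changes x. No separate proof that the span is stable under the group is
    required. *)
Lemma gen_subrep_sub_span u : gen_subrep A u ->
  forall f x, u = pi f -> \det x = 1 -> lower_span (sub_mx x f).
Proof.
have cong f g x : pi f = pi g -> \det x = 1 -> lower_span (sub_mx x g) -> lower_span (sub_mx x f).
  move=> /pi_eqP[h ->] dx; rewrite rmorphD rmorphM /= sub_mx_rel // => Wg.
  by apply: (subspaceD subspace_lower_span) => //; apply: lower_span_ideal.
elim=> [p Ap|| {}u v _ IHu _ IHv | t {}u _ IHu | g {}u dg _ IHu] f x ef dx.
- exact: (cong f (iota_ab p)) (esym ef) dx (lower_span_sub_iota x Ap).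
- apply: (cong f 0 x _ dx); last by rewrite linear0; apply: subspace_lower_span.1.
  by rewrite -ef rmorph0.
- apply: (cong f (repr u + repr v) x _ dx); first by rewrite -ef rmorphD /= !reprK.
  rewrite linearD; apply: (subspaceD subspace_lower_span).
    exact: IHu (esym (reprK u)) dx.
  exact: IHv (esym (reprK v)) dx.
- apply: (cong f (t *: repr u) x _ dx); first by rewrite -ef -mul_mpolyC rmorphM /= reprK.
  by rewrite linearZ; apply: (subspaceZ subspace_lower_span); exact: IHu (esym (reprK u)) dx.
apply: (cong f (mpoly_act g (repr u)) x _ dx); first by rewrite -ef.
rewrite mpoly_actE sub_mx_mul; apply: (IHu _ _ (esym (reprK u))).
by rewrite det_mulmx det_inv dg dx invr1 mulr1.
Qed.

Lemma gen_subrep_span f : gen_subrep A (pi f) -> lower_span f.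
Proof. by move=> Gf; rewrite -(sub_mx1 f); apply: (gen_subrep_sub_span Gf) => //; apply: det1. Qed.

(** Injectivity of [kab_to_kSL2], in the form that reads identities modulo the ideal back in
    k[a,b]. *)
Lemma iota_ab_eq0 p h : iota_ab p = h * rel -> p = 0.
Proof.
move=> e; apply: (@kab_to_kSL2_inj k); apply/pi_eqP; exists h.
by rewrite comp_mpoly0 add0r.
Qed.

Lemma iter_raise_ideal e h : iter e E (h * rel) = iter e E h * rel.
Proof. exact: (iter_der_constM (@raiseM k) _ _ (raise_rel k)). Qed.

(** The operator on k[a,b] induced by E^N D^N, with a scalar for each degree because elements of A
    may be inhomogeneous. *)
Definition raise_lower_scale N (p : {mpoly k[2]}) : {mpoly k[2]} :=
  \sum_(n < msize p) pihomog mdeg n p *+ (n ^_ N * N`!).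

Lemma iter_raise_lower_all N p :
  iter N E (iter N D (iota_ab p)) = iota_ab (raise_lower_scale N p).
Proof.
rewrite {1}(@pihomog_partitionE _ _ mdeg _ p (leqnn _)) /raise_lower_scale.
rewrite !linear_sum !iter_der_sum; apply: eq_bigr => n _.
by rewrite raddfMn; apply: (iter_raise_lower char0); apply: pihomogP.
Qed.

(** D^N kills components of degree below N; in degree n >= N the scalar n^_N N! is nonzero in
    characteristic 0. *)
Lemma raise_lower_scale_eq0 N p : raise_lower_scale N p = 0 -> iter N D (iota_ab p) = 0.
Proof.
move=> e0; rewrite (@pihomog_partitionE _ _ mdeg _ p (leqnn _)).
rewrite linear_sum iter_der_sum big1 // => n _.
have [ltnN|leNn] := ltnP n N; first exact: (iter_lower_homog0 char0 ltnN (pihomogP _ _ _)).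
have /(congr1 (pihomog mdeg n)) := e0.
rewrite linear0 linear_sum /= (bigD1 n) //= big1 ?addr0 => [|i ne_in].
  rewrite raddfMn /= pihomog_id -scaler_nat => /eqP.
  rewrite scaler_eq0 (negPf (natr_neq0 char0 _)) ?muln_gt0 ?ffact_gt0 ?leNn ?fact_gt0 //=.
  by move/eqP->; rewrite linear0 iter_der0.
rewrite raddfMn /= (@pihomog_ne0 _ _ _ i) ?mul0rn ?pihomogP //.
Qed.

(* If w is a sum of D^e r_e with e < N then applying E^(N-1) kills w and all
   the terms with e < N - 1, so it forces D^(N-1) r_(N-1) = 0. *)
Lemma lower_span_iota_in w : lower_span (iota_ab w) -> w \in A.
Proof.
(* Lengths 0 and 1 stand apart, since E^(N-1) kills [iota_ab w] only for N > 1. In length 1, w and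
   [r 0] agree modulo the ideal, hence are equal. *)
case=> N [r [h [Ar ew]]]; elim: N h ew => [|[|N] IHN] h.
- by rewrite big_ord0 add0r => /iota_ab_eq0->; apply: subspaceA.1.
- rewrite big_ord1 /= => ew; suff -> : w = r 0%N by [].
  apply/eqP; rewrite -subr_eq0; apply/eqP/(@iota_ab_eq0 _ h).
  by rewrite linearB /= ew addrC addKr.
rewrite big_ord_recr => ew; apply: (IHN h).
have {}ew : iota_ab w = \sum_(e < N.+1) iter e D (iota_ab (r e))
    + iter N.+1 D (iota_ab (r N.+1)) + h * rel by exact: ew.
suff e0 : iter N.+1 D (iota_ab (r N.+1)) = 0 by rewrite ew e0 addr0.
apply: raise_lower_scale_eq0.
have low e : (e < N.+1)%N -> iter N.+1 E (iter e D (iota_ab (r e))) = 0.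
  move=> lte; rewrite -(subnK lte) addnS -addSn iterD iter_raise_lower_all.
  by rewrite iterSr raise_iota // iter_der0.
have Esum : iter N.+1 E (\sum_(e < N.+1) iter e D (iota_ab (r e))) = 0.
  by rewrite (iter_der_sum E) big1 // => e _; apply: low.
have Ew : iter N.+1 E (iota_ab w) = 0 by rewrite iterSr raise_iota // iter_der0.
move: Ew; rewrite ew (iter_derD E) (iter_derD E) Esum add0r iter_raise_lower_all.
(* E preserves the ideal as well, so the surviving term is an element of k[a,b] lying in the
   ideal. *)
rewrite iter_raise_ideal => e.
apply: (@iota_ab_eq0 _ (- iter N.+1 E h)); rewrite mulNr.
by apply/eqP; rewrite -subr_eq0 opprK e.
Qed.

Definition in_subrep f := gen_subrep A (pi f).

Lemma subspace_in_subrep : subspace in_subrep.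
Proof.
split=> [|c u v Gu Gv]; first by rewrite /in_subrep rmorph0; apply: gen_subrep_zero.
rewrite /in_subrep rmorphD /= -mul_mpolyC rmorphM /=.
by apply: gen_subrep_add => //; apply: gen_subrep_scale.
Qed.

Lemma in_subrep_pi f g : pi f = pi g -> in_subrep g -> in_subrep f.
Proof. by rewrite /in_subrep => ->. Qed.

Lemma in_subrep_sub x f : \det x = 1 -> in_subrep f -> in_subrep (sub_mx x f).
Proof.
move=> dx Gf; have dx' : \det (invmx x) = 1 by rewrite det_inv dx invr1.
by rewrite /in_subrep /sub_mx -(kSL2_act_pi _ dx'); apply: gen_subrep_act.
Qed.

(** The matrices with rows (1, t) and (0, 1) send a form q to the sum of the t^e D^e q / e!;
    [subspace_coef] then isolates each D^e q. *)
Lemma in_subrep_lower e p : p \in A -> in_subrep (iter e D (iota_ab p)).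
Proof.
move=> Ap; apply: (@subspace_pihomog _ (fun p => in_subrep (iter e D (iota_ab p)))).
  split=> [|c u v Gu Gv]; first by rewrite linear0 iter_der0; apply: subspace_in_subrep.1.
  by rewrite linearP iter_derD iter_derZ; apply: subspace_in_subrep.2 Gu Gv.
move=> n; set q := pihomog mdeg n p.
have homq : q \is n.-homog by apply: pihomogP.
have [ltne|leen] := ltnP n e.
  by rewrite (iter_lower_homog0 char0 ltne homq); apply: subspace_in_subrep.1.
have f0 : (e`!%:R)^-1 != 0 :> k by rewrite invr_eq0 (natr_neq0 char0) // fact_gt0.
apply: (subspaceZ_inv subspace_in_subrep f0).
apply: (subspace_coef subspace_in_subrep char0
  (x := fun e => (e`!%:R)^-1 *: iter e D (iota_ab q)) (N := n.+1)) => // t.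
pose x : 'M[k]_2 := \matrix_(i, j) (if i == 0 then if j == 0 then 1 else t else (j != 0)%:R).
have dx : \det x = 1.
  rewrite (expand_det_col _ 0) !big_ord_recl big_ord0 addr0 /cofactor !det_mx11 !mxE /=.
  by rewrite expr0 mul0r addr0 !mul1r.
have Gq : in_subrep (iota_ab q) by apply: gen_subrep_incl; apply: gradedA.
have := in_subrep_sub dx Gq; rewrite sub_mx_iota (taylor_lower char0 _ _ homq) !mxE /=.
congr in_subrep; apply: eq_bigr => i _.
by rewrite expr1n mul1r scalerA.
Qed.

(** Together with [gen_subrep_span], this identifies V_A with the span. *)
Lemma in_subrep_span f : lower_span f -> in_subrep f.
Proof.
case=> N [r [h [Ar ->]]].
apply: (@in_subrep_pi _ (\sum_(e < N) iter e D (iota_ab (r e)))).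
  by apply/pi_eqP; exists h.
by apply: (subspace_sum subspace_in_subrep) => e _; apply: in_subrep_lower.
Qed.

Lemma transvectant_pi n1 n2 s p1 p2 : (s <= n1)%N -> (s <= n2)%N ->
  p1 \is n1.-homog -> p2 \is n2.-homog ->
  pi (transvectant n1 n2 s p1 p2) = pi (iota_ab (w_poly n1 n2 p1 p2 s)).
Proof.
move=> les1 les2 hom1 hom2.
have [w ew] := transvectant_det char0 les1 les2 hom1 hom2.
rewrite -(transvectant_w_poly char0 les1 les2 hom1 hom2 ew) ew rmorphM rmorphXn /=.
have -> : pi (va * vd - vb * vc) = pi 1 by apply/pi_eqP; exists 1; rewrite SL2_relE; ring.
by rewrite !rmorph1 expr1n mul1r.
Qed.

(** The transvectant is a combination of products of elements of V_A and has the same class as w_s;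
    [lower_span_iota_in] then brings w_s back into A. *)
Lemma w_poly_in n1 n2 s p1 p2 :
  (forall u v, gen_subrep A u -> gen_subrep A v -> gen_subrep A (u * v)) ->
  p1 \in A -> p2 \in A -> p1 \is n1.-homog -> p2 \is n2.-homog ->
  (s <= n1)%N -> (s <= n2)%N -> w_poly n1 n2 p1 p2 s \in A.
Proof.
move=> mulA A1 A2 hom1 hom2 les1 les2; apply: lower_span_iota_in.
apply: gen_subrep_span; rewrite -transvectant_pi //.
apply: (subspace_sum subspace_in_subrep) => e _; apply: (subspaceZ subspace_in_subrep).
by rewrite /in_subrep rmorphM; apply: mulA; apply: in_subrep_lower.
Qed.

(** * From the condition on the w_s to products in V_A *)

Section MulClosed.
Hypothesis wA : forall (n1 n2 : nat) (p1 p2 : {mpoly k[2]}),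
  p1 \in A -> p2 \in A -> p1 \is n1.-homog -> p2 \is n2.-homog ->
  forall s : nat, (s <= minn n1 n2)%N -> w_poly n1 n2 p1 p2 s \in A.

Let W := subspace_lower_span.

(* Modulo the image of the level s - 1 under D, the products
   D^e p D^(s - e) q agree up to the sign (-1)^e, and the s-th transvectant is
   a positive multiple of each of them. *)
Lemma lower_span_homogM n1 n2 p q : p \in A -> q \in A ->
  p \is n1.-homog -> q \is n2.-homog ->
  forall s e, (e <= s)%N -> lower_span (iter e D (iota_ab p) * iter (s - e) D (iota_ab q)).
Proof.
move=> Ap Aq homp homq.
pose v s e := iter e D (iota_ab p) * iter (s - e) D (iota_ab q).
(* If neighbouring products of level s cancel modulo the span, all of them agree up to sign, and it
   remains to place [v s 0] in the span. *)
have step s : (forall e, (e < s)%N -> lower_span (v s e + v s e.+1)) ->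
    forall e, (e <= s)%N -> lower_span (v s e).
  move=> Wv.
  have alt e : (e <= s)%N -> lower_span (v s e - (-1) ^+ e *: v s 0%N).
    elim: e => [|e IHe] les; first by rewrite expr0 scale1r subrr; apply: W.1.
    have := subspaceB W (Wv e les) (IHe (ltnW les)).
    by rewrite exprS mulN1r scaleNr opprK opprB addrC addrA subrK addrC.
  suff Wv0 : lower_span (v s 0%N).
    move=> e les; rewrite -(subrK ((-1) ^+ e *: v s 0%N) (v s e)).
    by apply: (subspaceD W); [exact: alt | exact: (subspaceZ W)].
  (* Beyond min(n1, n2) the hypothesis [wA] says nothing, but then D^s kills q or p, so [v s 0] or
     [v s s] is zero. *)
  have [lt2|les2] := ltnP n2 s.
    by rewrite /v subn0 (iter_lower_homog0 char0 lt2 homq) mulr0; apply: W.1.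
  have [lt1|les1] := ltnP n1 s.
    have := alt s (leqnn s); rewrite {1}/v (iter_lower_homog0 char0 lt1 homp) mul0r sub0r -scaleNr.
    by apply: (subspaceZ_inv W); rewrite oppr_eq0 signr_eq0.
  have Wt : lower_span (transvectant n1 n2 s p q).
    apply: (lower_span_pi (transvectant_pi les1 les2 homp homq)).
    by apply: (@lower_span_iota 0); apply: wA => //; rewrite leq_min les1.
  pose c e : k := (-1) ^+ e * 'C(s, e)%:R / ((n1 ^_ e)%:R * (n2 ^_ (s - e))%:R).
  (* Replacing each [v s e] in the transvectant by (-1)^e [v s 0] leaves a scalar multiple of
     [v s 0]. *)
  have := subspaceB W Wt (subspace_sum W (index_enum 'I_s.+1) (P := predT)
    (fun e _ => subspaceZ W (c e) (alt e (ltn_ord e)))).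
  rewrite -sumrB (eq_bigr (fun e : 'I_s.+1 => (c e * (-1) ^+ e) *: v s 0%N)) => [|e _]; last first.
    by rewrite -scalerBr /v opprB addrC subrK scalerA.
  rewrite -scaler_suml; apply: (subspaceZ_inv W).
  (* The two signs (-1)^e cancel, so the scalar is a positive integer over n1! n2!, nonzero in
     characteristic 0. *)
  suff -> : \sum_(e < s.+1) c e * (-1) ^+ e =
      (\sum_(e < s.+1) 'C(s, e) * (n1 - e)`! * (n2 - (s - e))`!)%N%:R / (n1`! * n2`!)%:R.
    rewrite mulf_neq0 ?invr_eq0 ?(natr_neq0 char0) ?muln_gt0 ?fact_gt0 //.
    by rewrite big_ord_recl ltn_addr // bin0 !muln_gt0 !fact_gt0.
  rewrite natr_sum mulr_suml; apply: eq_bigr => e _.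
  have lee : (e <= s)%N by rewrite -ltnS.
  rewrite -(@ffact_fact n1 e); last by lia.
  rewrite -(@ffact_fact n2 (s - e)); last by lia.
  rewrite !natrM /c.
  have f1 : (n1 ^_ e)%:R != 0 :> k by rewrite (natr_neq0 char0) // ffact_gt0; lia.
  have f2 : (n2 ^_ (s - e))%:R != 0 :> k by rewrite (natr_neq0 char0) // ffact_gt0; lia.
  have f3 : (n1 - e)`!%:R != 0 :> k by rewrite (natr_neq0 char0) // fact_gt0.
  have f4 : (n2 - (s - e))`!%:R != 0 :> k by rewrite (natr_neq0 char0) // fact_gt0.
  have := sqrr_sign k e; move: ((-1) ^+ e) => sg sg2.
  transitivity (sg ^+ 2 * 'C(s, e)%:R / ((n1 ^_ e)%:R * (n2 ^_ (s - e))%:R)).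
    by field; rewrite f1 f2.
  by rewrite sg2; field; rewrite f1 f2 f3 f4.
elim=> [|s IHs]; apply: step => // e; rewrite ltnS => les.
(* By the Leibniz rule, D of a product of level s is the sum of two neighbours of level s + 1. *)
have := lower_span_lower (IHs e les); rewrite lowerM addrC.
by rewrite /v subSS subSn.
Qed.

Lemma lower_span_iotaM p q e : p \in A -> q \in A ->
  lower_span (iota_ab p * iter e D (iota_ab q)).
Proof.
move=> Ap Aq; apply: (@subspace_pihomog _ (fun p => lower_span (iota_ab p * iter e D (iota_ab q)))).
  split=> [|c u v Su Sv]; first by rewrite linear0 mul0r; apply: W.1.
  by rewrite linearP mulrDl -scalerAl; apply: W.2 Su Sv.
move=> n1; apply: (@subspace_pihomog _ (fun q => lower_span (iota_ab _ * iter e D (iota_ab q)))).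
  split=> [|c u v Su Sv]; first by rewrite linear0 iter_der0 mulr0; apply: W.1.
  by rewrite linearP iter_derD iter_derZ mulrDr -scalerAr; apply: W.2 Su Sv.
move=> n2; have := lower_span_homogM (gradedA n1 Ap) (gradedA n2 Aq)
  (pihomogP _ _ _) (pihomogP _ _ _) (leq0n e).
by rewrite subn0.
Qed.

(** Induction on the generation of u, for all v at once: (g u) v = g (u (g^-1 v)) shifts the action
    to v, so that only products of an element of A with some D^e(q), q in A, must be computed. *)
Lemma gen_subrepM u v : gen_subrep A u -> gen_subrep A v -> gen_subrep A (u * v).
Proof.
move=> Gu; elim: Gu v => [p Ap|| {}u u' _ IHu _ IHu' | t {}u _ IHu | g {}u dg _ IHu] v Gv.
- rewrite -[v]reprK in Gv *; have [N [r [h [Ar ->]]]] := gen_subrep_span Gv.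
  rewrite -[kab_to_kSL2 p]/(pi (iota_ab p)) -rmorphM /=.
  apply: in_subrep_span; rewrite mulrDr mulr_sumr mulrA.
  apply: (subspaceD W); last exact: lower_span_ideal.
  by apply: (subspace_sum W) => e _; apply: lower_span_iotaM.
- by rewrite mul0r; apply: gen_subrep_zero.
- by rewrite mulrDl; apply: gen_subrep_add; [apply: IHu | apply: IHu'].
- by rewrite /kSL2_scale -mulrA; apply: gen_subrep_scale; apply: IHu.
have ug : g \in unitmx by rewrite unitmxE dg unitr1.
have dg' : \det (invmx g) = 1 by rewrite det_inv dg invr1.
have := gen_subrep_act dg (IHu _ (gen_subrep_act dg' Gv)).
congr (gen_subrep A).
rewrite -(reprK u) -(reprK v); move: (repr u) (repr v) => fu fv.
rewrite (kSL2_act_pi _ dg') -(rmorphM pi) !(kSL2_act_pi _ dg) -(rmorphM pi).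
congr pi; rewrite !mpoly_actE rmorphM /= sub_mx_mul invmxK.
by rewrite mulmxV // sub_mx1.
Qed.

End MulClosed.

End GeneratedSubrep.

Theorem proposition3p6 (k : closedFieldType) (char0 : [pchar k] =i pred0)
    (A : {pred {mpoly k[2]}}) (subalgA : GRing.subalg_closed A)
    (normalA : normal_subalg A) (fin_genA : fin_gen_subalg A)
    (gradedA : graded_subalg A) :
  admissible A <->
  (forall (n1 n2 : nat) (p1 p2 : {mpoly k[2]}),
     p1 \in A -> p2 \in A -> p1 \is n1.-homog -> p2 \is n2.-homog ->
     forall s : nat, (s <= minn n1 n2)%N -> w_poly n1 n2 p1 p2 s \in A).
Proof.
split=> [[_ _ _ mulA] n1 n2 p1 p2 A1 A2 hom1 hom2 s|wA].
  by rewrite leq_min => /andP[les1 les2]; apply: w_poly_in.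
by split=> // u v; apply: gen_subrepM.
Qed.
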